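(* Let $q \ge 2$ be a fixed integer and let $c_q = q H_q$, where $H_q = \sum_{i=1}^{q} 1/i$. Let $n = n(k)$ be a function of $k$, and for each $k$ let $w$ be a word of length $n = n(k)$ over the $q$-symbol alphabet chosen uniformly at random. For every $\varepsilon > 0$ we have \[ \Pr[\,w \text{ is } k\text{-universal}\,] \rightarrow \begin{cases} 0 & \text{if } n \le (1-\varepsilon) c_q k, \text{ and}\\ 1 & \text{if } n \ge (1+\varepsilon) c_q k, \end{cases} \] where the limit is taken as $k \to \infty$ (and in each case the inequality on $n = n(k)$ is assumed for all $k$).
   Context: Let $\Sigma = [q] = \{1,\dots,q\}$ be an alphabet with $q$ symbols. A word of length $n$ over $\Sigma$ is a sequence of $n$ symbols of $\Sigma$; a uniformly chosen word of length $n$ is a uniformly random element of $\Sigma^n$. A word $w$ contains a word $w'$ if $w'$ can be obtained from $w$ by deleting letters, i.e. $w'$ is a (not necessarily contiguous) subsequence of $w$. A word over $\Sigma$ is $k$-universal if it contains every word over $\Sigma$ of length at most $k$ (equivalently, every word over $\Sigma$ of length exactly $k$). *)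

(* Defs.v *)
From mathcomp Require Import all_boot all_order all_algebra.
From mathcomp Require Import all_classical all_reals all_analysis.

Set Implicit Arguments.
Unset Strict Implicit.
Unset Printing Implicit Defensive.

Import Order.TTheory GRing.Theory Num.Theory.
Import numFieldNormedType.Exports.

Local Open Scope ring_scope.

(* The alphabet {1, ..., q} is represented by 'I_q = {0, ..., q - 1};
   subseq is the not necessarily contiguous subsequence relation. *)
Definition universal (q k : nat) (w : seq 'I_q) : Prop :=
  forall u : seq 'I_q, (size u <= k)%N -> subseq u w.

(* Probability of the event P under the uniform distribution on a nonempty
   finite type T. *)
Definition uniform_pr (R : realType) (T : finType) (P : T -> Prop) : R :=
  #|[pred x : T | `[< P x >]]|%:R / #|T|%:R.

Definition harmonic_number (R : realType) (q : nat) : R :=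
  \sum_(1 <= i < q.+1) i%:R^-1.

Definition univ_threshold (R : realType) (q : nat) : R :=
  q%:R * harmonic_number R q.

(* Main.v *)
Require Import Defs.
From mathcomp Require Import all_boot all_order all_algebra.
From mathcomp Require Import all_classical all_reals all_analysis.
From mathcomp Require Import ring lra.

Import Order.TTheory GRing.Theory Num.Theory.
Import numFieldNormedType.Exports.

(** A word can be cut greedily into arches: blocks each of which ends as soon as
    it contains all [q] letters.  A word with [a] complete
    arches contains every word of length [a], because each arch supplies any
    desired letter.  Conversely the sequence of letters that complete the arches,
    extended by one letter missing from the unfinished arch, is a word of length
    [a + 1] that does not occur.  Hence a word is [k]-universal exactly when it
    has at least [k] arches ([universal_arches]).

    In a random word every arch is a run of the coupon collector, of mean length
    [c = q H_q].  Instead of a law of large numbers for the arch lengths, the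
    proof follows one potential, [progress]: [c] times the number of complete
    arches, plus the mean time to collect as many distinct letters as the
    unfinished arch has.  If that arch has [s] letters, a new letter appears with
    probability [(q - s) / q] and raises the potential by [q / (q - s)], and a
    repeated letter leaves it unchanged.  So the potential grows by exactly [1] on
    average, the increments have variance at most [q], and the deviation
    [progress w - n] is a martingale: its second moment over words of length [n]
    is at most [n q] ([sum_progress_dev]).

    The potential lies between [a c] and [(a + 1) c], so a word is [k]-universal
    exactly when its potential is at least [c k] ([progress_universal]).  If [n]
    is away from [c k] by a factor [1 - eps] or [1 + eps], the undesired outcome
    forces a deviation of order [k], respectively [n], and Chebyshev's inequality
    bounds its probability by a constant over [k]. *)

Local Open Scope classical_set_scope.
Local Open Scope ring_scope.

(** * Arches and universality *)

(** The state is the number of complete arches together with the set of letters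
    of the unfinished one.  The set is never full: completing it opens a new,
    empty arch. *)
Definition arch_step (q : nat) (x : 'I_q) (s : nat * {set 'I_q}) :
    nat * {set 'I_q} :=
  if x |: s.2 == [set: 'I_q]%SET then (s.1.+1, finset.set0)
  else (s.1, x |: s.2).

(** Letters are processed from the right end of the word.  Universality and the
    uniform distribution are invariant under reversal, and this direction makes
    the first letter of a word the last one read, which agrees with the recursion
    of [subseq]. *)
Definition arch_state (q : nat) (w : seq 'I_q) : nat * {set 'I_q} :=
  foldr (@arch_step q) (0%N, finset.set0) w.

Lemma arch_state_not_full (q : nat) (w : seq 'I_q) :
  (0 < q)%N -> (arch_state q w).2 != [set: 'I_q]%SET.
Proof.
move=> q_gt0; have set0_neq : finset.set0 != [set: 'I_q]%SET.
  by rewrite eq_sym; apply/finset.set0Pn; exists (Ordinal q_gt0).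
case: w => [|x w] //=.
by rewrite /arch_step; case: ifPn.
Qed.

Lemma arch_state_card (q : nat) (w : seq 'I_q) :
  (0 < q)%N -> (#|(arch_state q w).2| < q)%N.
Proof.
move=> q_gt0; rewrite -[X in (_ < X)%N]card_ord -cardsT proper_card // properT.
exact: arch_state_not_full.
Qed.

(** Each arch supplies one arbitrary letter.  The induction needs the second
    clause: the unfinished arch supplies one more letter, if it has it. *)
Lemma arches_universal (q : nat) (w : seq 'I_q) :
  (forall u : seq 'I_q, (size u <= (arch_state q w).1)%N -> subseq u w) /\
  (forall (y : 'I_q) (u : seq 'I_q), y \in (arch_state q w).2 ->
     (size u <= (arch_state q w).1)%N -> subseq (y :: u) w).
Proof.
elim: w => [|x w [IHu IHy]]; first by split=> [[]|y u] //=; rewrite inE.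
have cons_sub u : subseq u w -> subseq u (x :: w).
  by move=> uw; apply: subseq_trans uw (subseq_cons _ _).
have grow y u : y \in x |: (arch_state q w).2 ->
    (size u <= (arch_state q w).1)%N -> subseq (y :: u) (x :: w).
  rewrite finset.in_setU1 => /orP[/eqP-> u_le|yS u_le]; last exact/cons_sub/IHy.
  by rewrite /= eqxx; apply: IHu.
rewrite [arch_state q (x :: w)]/= -/(arch_state q w) /arch_step.
case: eqP => [full|_] /=; split=> //.
- case=> [|y u] //; rewrite ltnS; apply: grow.
  by rewrite full inE.
- by move=> y u; rewrite inE.
- by move=> u u_le; apply/cons_sub/IHu.
Qed.

(** The avoided word consists of the letters that completed the arches.  Such a
    letter occurs only once in its arch, at the left end, so no letter put in
    front of it can be matched inside the same arch. *)
Lemma arches_avoid (q : nat) (w : seq 'I_q) : (0 < q)%N ->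
  exists2 u : seq 'I_q, size u = (arch_state q w).1 &
    forall y : 'I_q, y \notin (arch_state q w).2 -> ~~ subseq (y :: u) w.
Proof.
move=> q_gt0; elim: w => [|x w [u size_u avoid]]; first by exists [::].
rewrite [arch_state q (x :: w)]/= -/(arch_state q w) /arch_step.
case: eqP => [full|_] /=; last first.
  exists u => // y; rewrite finset.in_setU1 negb_or => /andP[/negPf-> yS].
  exact: avoid.
have x_avoid : ~~ subseq (x :: u) w.
  apply: avoid; apply: contra (arch_state_not_full q w q_gt0) => xS.
  by rewrite -full; apply/eqP/esym/finset.setUidPr; rewrite finset.sub1set.
exists (x :: u) => [|y _]; first by rewrite /= size_u.
case: eqP => // _; apply: contra x_avoid.
exact: subseq_trans (subseq_cons _ _).
Qed.

Lemma universal_arches (q k : nat) (w : seq 'I_q) : (0 < q)%N ->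
  universal k w <-> (k <= (arch_state q w).1)%N.
Proof.
move=> q_gt0; split=> [univ|k_le u u_le]; last first.
  exact/(arches_universal q w).1/(leq_trans u_le).
rewrite leqNgt; apply/negP => lt_k.
have [u size_u avoid] := arches_avoid q w q_gt0.
have := arch_state_not_full q w q_gt0.
rewrite -finset.subTset => /subsetPn[y _ yS].
by move: (avoid y yS); rewrite univ //= size_u.
Qed.

(** * The potential *)

(** The mean number of uniform letters drawn until [s] distinct ones have
    appeared: with [i] of them seen, the waiting time for the next is geometric
    of mean [q / (q - i)]. *)
Definition coupon_time (R : realType) (q s : nat) : R :=
  \sum_(i < s) q%:R / (q - i)%:R.

Lemma coupon_timeS (R : realType) (q s : nat) :
  coupon_time R q s.+1 = coupon_time R q s + q%:R / (q - s)%:R.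
Proof. by rewrite /coupon_time big_ord_recr. Qed.

Lemma coupon_time_ge0 (R : realType) (q s : nat) : 0 <= coupon_time R q s.
Proof. by apply: sumr_ge0 => i _; rewrite divr_ge0. Qed.

Lemma coupon_time_full (R : realType) (q : nat) :
  coupon_time R q q = univ_threshold R q.
Proof.
rewrite /coupon_time /univ_threshold /harmonic_number -mulr_sumr.
congr (_ * _); rewrite big_add1 /= big_mkord (reindex_inj rev_ord_inj) /=.
by apply: eq_bigr => i _; rewrite subKn.
Qed.

Lemma coupon_time_lt (R : realType) (q s : nat) : (s < q)%N ->
  coupon_time R q s < univ_threshold R q.
Proof.
rewrite -coupon_time_full => lt_sq.
have mono d : (s.+1 + d <= q)%N ->
    coupon_time R q s < coupon_time R q (s.+1 + d).
  elim: d => [|d IH] le_q.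
    rewrite addn0 coupon_timeS ltrDl divr_gt0 ?ltr0n ?subn_gt0 //.
    exact: leq_ltn_trans lt_sq.
  rewrite addnS coupon_timeS.
  apply: (lt_le_trans (IH _)); first by apply: leq_trans le_q; rewrite leq_add2l.
  by rewrite lerDl divr_ge0.
by have := mono (q - s.+1)%N; rewrite subnKC //; apply.
Qed.

Definition progress (R : realType) (q : nat) (w : seq 'I_q) : R :=
  (arch_state q w).1%:R * univ_threshold R q
  + coupon_time R q #|(arch_state q w).2|.

(** Completing an arch is not an exceptional case: the last of the [q] letters
    brings the collecting time to [univ_threshold R q], which is the reward for one
    more complete arch, while the unfinished arch restarts from [0]. *)
Lemma progress_cons (R : realType) (q : nat) (x : 'I_q) (w : seq 'I_q) :
  (0 < q)%N ->
  progress R q (x :: w) = progress R q w +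
    (if x \in (arch_state q w).2 then 0
     else q%:R / (q - #|(arch_state q w).2|)%:R).
Proof.
move=> q_gt0; have := arch_state_not_full q w q_gt0.
rewrite /progress [arch_state q (x :: w)]/= -/(arch_state q w) /arch_step.
case: (arch_state q w) => a S /= S_neq.
case: (boolP (x \in S)) => xS.
  have -> : x |: S = S by apply/finset.setUidPr; rewrite finset.sub1set.
  by rewrite (negPf S_neq) addr0.
have card_xS : #|x |: S| = #|S|.+1 by rewrite cardsU1 xS.
case: eqP => [full|_] /=; last by rewrite card_xS coupon_timeS addrA.
have S_card : #|S|.+1 = q by rewrite -card_xS full cardsT card_ord.
rewrite finset.cards0 /coupon_time big_ord0 -/(coupon_time R q _) addr0.
rewrite -addrA -coupon_timeS S_card coupon_time_full.
by rewrite -natr1 mulrDl mul1r.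
Qed.

(** The contribution of the unfinished arch is less than that of a complete one,
    so the potential determines the number of arches. *)
Lemma progress_universal (R : realType) (q k : nat) (w : seq 'I_q) :
  (0 < q)%N ->
  universal k w <-> univ_threshold R q * k%:R <= progress R q w.
Proof.
move=> q_gt0.
have S_lt := arch_state_card q w q_gt0.
have c_gt0 := le_lt_trans (coupon_time_ge0 R q _) (coupon_time_lt R q _ S_lt).
rewrite universal_arches // /progress; split=> [k_le|].
  rewrite mulrC ler_wpDr ?coupon_time_ge0 //.
  by rewrite ler_pM2r // ler_nat.
apply: contraTT; rewrite -ltnNge -ltNge => lt_k.
apply: (@lt_le_trans _ _ ((arch_state q w).1.+1%:R * univ_threshold R q)).
  by rewrite -natr1 mulrDl mul1r ltrD2l coupon_time_lt.
by rewrite mulrC ler_pM2l // ler_nat.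
Qed.

(** * The second moment of the deviation *)

Lemma sum_tuple_cons (R : realType) (T : finType) (n : nat)
    (F : seq T -> R) :
  \sum_(w : n.+1.-tuple T) F w = \sum_(w : n.-tuple T) \sum_(x : T) F (x :: w).
Proof.
rewrite pair_big /= (reindex (fun p : n.-tuple T * T => cons_tuple p.2 p.1)) //.
exists (fun w : n.+1.-tuple T => (behead_tuple w, thead w)) => [[w x] _|w _] /=.
  by congr pair; apply/val_inj.
by rewrite [RHS]tuple_eta; apply/val_inj.
Qed.

(** The martingale step.  Summed over the letter [x], the increment minus [1]
    vanishes, so in the expansion of the square the cross term with
    [progress R q w - m] disappears, and what is added is the second moment of the
    centred increment, at most [q * q] in total. *)
Lemma sum_progress_step (R : realType) (q : nat) (w : seq 'I_q) (m : R) :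
  (0 < q)%N ->
  \sum_(x : 'I_q) (progress R q (x :: w) - (m + 1)) ^+ 2
    <= q%:R * (progress R q w - m) ^+ 2 + q%:R * q%:R.
Proof.
move=> q_gt0; under eq_bigr do rewrite progress_cons //.
set M := progress R q w - m; set S := (arch_state q w).2.
have S_lt : (#|S| < q)%N := arch_state_card q w q_gt0.
set r : R := q%:R / (q - #|S|)%:R.
have cardC : #|~: S| = (q - #|S|)%N by rewrite cardsCs finset.setCK card_ord.
rewrite (bigID (mem S)) /=.
under eq_bigr => x xS do rewrite (xS : x \in S).
under [X in _ + X <= _]eq_bigr => x xS do rewrite (negPf xS).
rewrite !sumr_const.
have -> : #|[pred x | x \notin S]| = (q - #|S|)%N.
  by rewrite -cardC; apply: eq_card => x; rewrite !inE.
have -> : #|[pred x | x \in S]| = #|S| by apply: eq_card => x; rewrite !inE.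
set d := (q - #|S|)%N.
have q_eq : q%:R = #|S|%:R + d%:R :> R by rewrite -natrD subnKC // ltnW.
have d_ge1 : 1 <= d%:R :> R by rewrite ler1n subn_gt0.
have rd : r * d%:R = q%:R by rewrite /r divfK // gt_eqF // (lt_le_trans ltr01).
have r_le : r <= q%:R.
  by rewrite /r ler_pdivrMr ?(lt_le_trans ltr01) // ler_peMr.
have q_ge0 : 0 <= q%:R :> R by [].
rewrite -[X in X + _ <= _]mulr_natr -[X in _ + X <= _]mulr_natr.
have -> : progress R q w + 0 - (m + 1) = M - 1 by rewrite /M; ring.
have -> : progress R q w + r - (m + 1) = M - 1 + r by rewrite /M; ring.
(* The product [r * d] has to be isolated so that its value [q] can be used. *)
have -> : (M - 1) ^+ 2 * #|S|%:R + (M - 1 + r) ^+ 2 * d%:R =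
  (#|S|%:R + d%:R) * (M - 1) ^+ 2 + (2 * (M - 1) + r) * (r * d%:R) by ring.
rewrite -q_eq rd -subr_ge0.
have -> : q%:R * M ^+ 2 + q%:R * q%:R -
   (q%:R * (M - 1) ^+ 2 + (2 * (M - 1) + r) * q%:R) =
   q%:R * (q%:R - r) + q%:R by ring.
by rewrite addr_ge0 // mulr_ge0 // subr_ge0.
Qed.

Lemma sum_progress_dev (R : realType) (q n : nat) : (0 < q)%N ->
  \sum_(w : n.-tuple 'I_q) (progress R q w - n%:R) ^+ 2
    <= n%:R * q%:R * (q ^ n)%:R.
Proof.
move=> q_gt0; elim: n => [|n IH].
  rewrite mul0r mul0r big1 // => w _; rewrite tuple0 /progress /=.
  by rewrite finset.cards0 /coupon_time big_ord0 mul0r addr0 subrr expr0n.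
rewrite (sum_tuple_cons _ _ _ (fun w => (progress R q w - n.+1%:R) ^+ 2)).
rewrite -natr1.
apply: (@le_trans _ _ (\sum_(w : n.-tuple 'I_q)
    (q%:R * (progress R q w - n%:R) ^+ 2 + q%:R * q%:R))).
  by apply: ler_sum => w _; exact: sum_progress_step.
rewrite big_split /= -mulr_sumr sumr_const card_tuple card_ord -[X in _ + X]mulr_natr.
rewrite expnS natrM.
apply: (@le_trans _ _ (q%:R * (n%:R * q%:R * (q ^ n)%:R)
    + q%:R * q%:R * (q ^ n)%:R)).
  by rewrite lerD2r ler_wpM2l.
by rewrite le_eqVlt; apply/orP; left; apply/eqP; ring.
Qed.

(** * Tail bounds and the limits *)

(** Chebyshev's inequality for the potential. *)
Lemma uniform_pr_progress_dev (R : realType) (q n : nat)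
    (P : n.-tuple 'I_q -> Prop) (t : R) : (0 < q)%N -> 0 < t ->
  (forall w, P w -> t <= `|progress R q w - n%:R|) ->
  uniform_pr R P <= n%:R * q%:R / t ^+ 2.
Proof.
move=> q_gt0 t_gt0 dev.
rewrite /uniform_pr card_tuple card_ord.
have qn_gt0 : 0 < (q ^ n)%:R :> R by rewrite ltr0n expn_gt0 q_gt0.
rewrite ler_pdivrMr // mulrAC ler_pdivlMr ?exprn_gt0 //.
apply: le_trans (sum_progress_dev R q n q_gt0).
rewrite mulr_natl -sumr_const big_mkcond /=.
apply: ler_sum => w _; case: ifPn => [|_]; last exact: sqr_ge0.
rewrite inE => Pw; have t_le := dev w Pw.
by rewrite -[leRHS]real_normK ?num_real // lerXn2r // nnegrE ltW.
Qed.

Lemma uniform_pr_compl (R : realType) (T : finType) (P : T -> Prop) :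
  (0 < #|T|)%N -> uniform_pr R P = 1 - uniform_pr R (fun x => ~ P x).
Proof.
move=> T_gt0; apply/eqP; rewrite eq_sym subr_eq /uniform_pr -mulrDl -natrD.
have -> : #|[pred x | `[< ~ P x >]]| = #|[predC [pred x | `[< P x >]]]|.
  by apply: eq_card => x; rewrite !inE asbool_neg.
by rewrite cardC divff // pnatr_eq0 -lt0n.
Qed.

Lemma cvg_inv_nat (R : realType) (C : R) : C / k%:R @[k --> \oo] --> (0 : R).
Proof.
rewrite -(mulr0 C); apply: cvgMr; apply/gtr0_cvgV0; last exact: cvgr_idn.
by near=> k; rewrite ltr0n; near: k; exact: nbhs_infty_gt.
Unshelve. all: by end_near. Qed.

Lemma univ_threshold_gt0 (R : realType) (q : nat) :
  (0 < q)%N -> 0 < univ_threshold R q.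
Proof.
by move=> q_gt0; apply: le_lt_trans (coupon_time_lt R q 0 q_gt0);
  exact: coupon_time_ge0.
Qed.

Lemma uniform_pr_ge0 (R : realType) (T : finType) (P : T -> Prop) :
  0 <= uniform_pr R P.
Proof. by rewrite divr_ge0. Qed.

(** A universal word has potential at least [c k], hence is [eps c k] ahead of
    its length. *)
Lemma short_word_universal_pr (R : realType) (q n k : nat) (eps : R) :
  (0 < q)%N -> (0 < k)%N -> 0 < eps ->
  n%:R <= (1 - eps) * univ_threshold R q * k%:R ->
  uniform_pr R (fun w : n.-tuple 'I_q => universal k w)
    <= q%:R / (eps ^+ 2 * univ_threshold R q) / k%:R.
Proof.
move=> q_gt0 k_gt0 eps_gt0 hn.
have c_gt0 := univ_threshold_gt0 R q q_gt0.
set c := univ_threshold R q in c_gt0 hn *.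
have kR_gt0 : 0 < k%:R :> R by rewrite ltr0n.
have ck_gt0 : 0 < c * k%:R by rewrite mulr_gt0.
have eck_gt0 : 0 < eps * (c * k%:R) by rewrite mulr_gt0.
have nk : n%:R + eps * (c * k%:R) <= c * k%:R.
  rewrite -lerBrDr (le_trans hn) // le_eqVlt; apply/orP; left; apply/eqP; ring.
apply: (le_trans (uniform_pr_progress_dev R q n _ _ q_gt0 eck_gt0 _)).
  move=> w /(progress_universal R q k w q_gt0).
  by rewrite -/c => le_w; apply: le_trans (ler_norm _); lra.
have -> : q%:R / (eps ^+ 2 * c) / k%:R =
   (c * k%:R) * q%:R / (eps * (c * k%:R)) ^+ 2.
  by field; rewrite !gt_eqF.
by rewrite ler_pM2r ?invr_gt0 ?exprn_gt0 // ler_wpM2r //; lra.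
Qed.

(** The length [n] has only a lower bound, so the deviation is measured
    against [n] itself: a word that is not universal has potential below [c k],
    which is at most [n / (1 + eps)].  The resulting bound decreases in [n]. *)
Lemma long_word_not_universal_pr (R : realType) (q n k : nat) (eps : R) :
  (0 < q)%N -> (0 < k)%N -> 0 < eps ->
  (1 + eps) * univ_threshold R q * k%:R <= n%:R ->
  uniform_pr R (fun w : n.-tuple 'I_q => ~ universal k w)
    <= q%:R * (1 + eps) / (eps ^+ 2 * univ_threshold R q) / k%:R.
Proof.
move=> q_gt0 k_gt0 eps_gt0 hn.
have c_gt0 := univ_threshold_gt0 R q q_gt0.
set c := univ_threshold R q in c_gt0 hn *.
have kR_gt0 : 0 < k%:R :> R by rewrite ltr0n.
have ck_gt0 : 0 < c * k%:R by rewrite mulr_gt0.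
have e1_gt0 : 0 < 1 + eps by lra.
have nk : (1 + eps) * (c * k%:R) <= n%:R by rewrite mulrA.
have n_gt0 : 0 < n%:R :> R by apply: lt_le_trans nk; rewrite mulr_gt0.
have t_gt0 : 0 < eps / (1 + eps) * n%:R by rewrite mulr_gt0 // divr_gt0.
apply: (le_trans (uniform_pr_progress_dev R q n _ _ q_gt0 t_gt0 _)).
  move=> w /(progress_universal R q k w q_gt0)/negP.
  rewrite -/c -ltNge => lt_w; rewrite distrC; apply: le_trans (ler_norm _).
  have -> : eps / (1 + eps) * n%:R = n%:R - n%:R / (1 + eps).
    by field; rewrite gt_eqF.
  by rewrite lerD2l lerN2 (le_trans (ltW lt_w)) // ler_pdivlMr // mulrC.
have -> : n%:R * q%:R / (eps / (1 + eps) * n%:R) ^+ 2 =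
    q%:R * (1 + eps) / eps ^+ 2 * ((1 + eps) / n%:R).
  by field; rewrite !gt_eqF.
have -> : q%:R * (1 + eps) / (eps ^+ 2 * c) / k%:R =
    q%:R * (1 + eps) / eps ^+ 2 * (c * k%:R)^-1.
  by field; rewrite !gt_eqF.
apply: ler_wpM2l.
  by rewrite divr_ge0 ?exprn_ge0 ?mulr_ge0 // ltW.
by rewrite ler_pdivrMr // mulrC ler_pdivlMr.
Qed.

Theorem theorem2 (R : realType) (q : nat) (q_ge2 : (2 <= q)%N)
    (n : nat -> nat) (eps : R) (eps_gt0 : 0 < eps) :
  ((forall k : nat, (0 < k)%N ->
      (n k)%:R <= (1 - eps) * univ_threshold R q * k%:R) ->
    uniform_pr R (fun w : (n k).-tuple 'I_q => universal k w) @[k --> \oo]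
      --> (0 : R))
  /\
  ((forall k : nat, (0 < k)%N ->
      (n k)%:R >= (1 + eps) * univ_threshold R q * k%:R) ->
    uniform_pr R (fun w : (n k).-tuple 'I_q => universal k w) @[k --> \oo]
      --> (1 : R)).
Proof.
have q_gt0 : (0 < q)%N := ltnW q_ge2.
split=> hn.
  apply: (squeeze_cvgr _ (cvg_cst 0)
    (cvg_inv_nat R (q%:R / (eps ^+ 2 * univ_threshold R q)))).
  near=> k; have k_gt0 : (0 < k)%N by near: k; exact: nbhs_infty_gt.
  by rewrite uniform_pr_ge0 short_word_universal_pr // hn.
suff fail_cvg0 : uniform_pr R (fun w : (n k).-tuple 'I_q => ~ universal k w)
    @[k --> \oo] --> (0 : R).
  have compl_cvg1 : 1 - uniform_pr R (fun w : (n k).-tuple 'I_q =>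
      ~ universal k w) @[k --> \oo] --> (1 : R).
    rewrite -[X in _ `=>` nbhs X]subr0.
    by apply: cvgB fail_cvg0; exact: cvg_cst.
  apply: cvg_trans compl_cvg1; apply: near_eq_cvg; apply: nearW => k.
  by rewrite [RHS]uniform_pr_compl ?card_tuple ?card_ord ?expn_gt0 ?q_gt0.
apply: (squeeze_cvgr _ (cvg_cst 0)
  (cvg_inv_nat R (q%:R * (1 + eps) / (eps ^+ 2 * univ_threshold R q)))).
near=> k; have k_gt0 : (0 < k)%N by near: k; exact: nbhs_infty_gt.
by rewrite uniform_pr_ge0 long_word_not_universal_pr // hn.
Unshelve. all: by end_near. Qed.
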